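(* Let $n\ge1$, let $u\in S_n$ and let $m$ be an even positive integer. Then $\tilde G_m(u)=\{h\in S_n : (uh)^m=h^m\}$ is non-empty. Specifically, there exists $h\in\tilde G_m(u)$ such that $h^m=\mathrm{id}$. *)

(* Defs.v *)
From mathcomp Require Import all_boot all_fingroup.

Set Implicit Arguments.
Unset Strict Implicit.
Unset Printing Implicit Defensive.

Local Open Scope group_scope.

(* The product of {perm 'I_n} composes from left to right: (u * h) x = h (u x).
   Inversion is an isomorphism onto the group with the opposite convention. *)
Definition Gtilde (n m : nat) (u : 'S_n) : {set 'S_n} :=
  [set h : 'S_n | (u * h) ^+ m == h ^+ m].

(* Main.v *)
Require Import Defs.
From mathcomp Require Import all_boot all_fingroup.

Local Open Scope group_scope.

(** Every permutation [u] is a product of two permutations of order at most 2: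
    each cycle of [u] is a rotation of a regular polygon, and a reflection [h]
    of that polygon has order at most 2 and inverts the rotation, so that [u * h] is a reflection
    too. Choosing a base point [r] on each cycle, the reflection sends [u ^+ i]
    applied to [r] to [u ^- i] applied to [r] ([cycle_reflection]). Then
    [(u * h) ^+ 2 = 1 = h ^+ 2], and both powers [m] are trivial for any even
    [m]. *)

(** Powers of [u] commute, so from [v y = w y] one gets equality of the inverses
    at [y] by applying the inverse of [v * w]. This makes the
    reflection independent of the exponent chosen to reach a point. *)
Lemma cycle_inv_eq (T : finType) (u v w : {perm T}) (y : T) :
  v \in <[u]> -> w \in <[u]> -> v y = w y -> v^-1 y = w^-1 y.
Proof.
move=> vu wu vwy; apply: (@perm_inj _ (v * w)).
have vwC : v * w = w * v by exact: (centsP (cycle_abelian u)).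
by rewrite {2}vwC !permM !permKV.
Qed.

Definition cycle_reflection (T : finType) (u : {perm T}) (x : T) : T :=
  (u ^- findex u (froot u x) x) (froot u x).

Lemma froot_cycle (T : finType) (u w : {perm T}) (x : T) :
  w \in <[u]> -> froot u (w x) = froot u x.
Proof.
case/cycleP=> i ->; rewrite permX; apply/eqP.
rewrite eq_sym (root_connect (fconnect_sym (@perm_inj _ u))).
exact: fconnect_iter.
Qed.

Lemma froot_reach (T : finType) (u : {perm T}) (x : T) :
  (u ^+ findex u (froot u x) x) (froot u x) = x.
Proof.
rewrite permX iter_findex // (fconnect_sym (@perm_inj _ u)).
exact: connect_root.
Qed.

Lemma cycle_reflectionE (T : finType) (u w : {perm T}) (x : T) :
  w \in <[u]> -> w (froot u x) = x -> cycle_reflection T u x = w^-1 (froot u x).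
Proof.
move=> wu wx; apply: (@cycle_inv_eq _ u) => //; first exact: mem_cycle.
by rewrite froot_reach.
Qed.

Lemma cycle_reflection_involutive (T : finType) (u : {perm T}) :
  involutive (cycle_reflection T u).
Proof.
move=> x; set v := u ^+ findex u (froot u x) x.
have vu : v^-1 \in <[u]> by rewrite groupV mem_cycle.
have fxE : cycle_reflection T u x = v^-1 (froot u x) by [].
have rE : froot u (cycle_reflection T u x) = froot u x.
  rewrite fxE froot_cycle //.
  exact: (root_root (fconnect_sym (@perm_inj _ u))).
by rewrite (@cycle_reflectionE _ _ v^-1) ?rE // invgK froot_reach.
Qed.

(** Moving one step forward along the cycle moves the mirror image one step
    back; this is the relation [h * u * h = u^-1] of a dihedral group, in the
    form that makes [(u * h) ^+ 2] collapse to [h ^+ 2]. *)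
Lemma cycle_reflection_inverts (T : finType) (u : {perm T}) (x : T) :
  u (cycle_reflection T u (u x)) = cycle_reflection T u x.
Proof.
set v := u ^+ findex u (froot u x) x.
have rE : froot u (u x) = froot u x by rewrite froot_cycle ?cycle_id.
have vuE : (v * u) (froot u (u x)) = u x by rewrite rE permM froot_reach.
rewrite (@cycle_reflectionE _ _ (v * u)) ?groupM ?mem_cycle ?cycle_id //.
(* Written as u * v, the inverse applies that of u last, where u cancels it. *)
have vuC : v * u = u * v by rewrite -expgSr expgS.
by rewrite rE vuC invMg permM permKV.
Qed.

Lemma perm_inverted_by_involution (T : finType) (u : {perm T}) :
  exists h : {perm T}, h ^+ 2 = 1 /\ (u * h) ^+ 2 = 1.
Proof.
have fK := cycle_reflection_involutive T u.
exists (perm (can_inj fK)); split; apply/permP=> x.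
  by rewrite expgS expg1 permM !permE fK.
rewrite expgS expg1 !permM perm1 !permE cycle_reflection_inverts.
exact: fK.
Qed.

Theorem proposition3p5p3 (n : nat) (hn : (1 <= n)%N) (u : 'S_n)
    (m : nat) (hm0 : (0 < m)%N) (hm : ~~ odd m) :
  Gtilde m u != set0 /\
  exists h : 'S_n, h \in Gtilde m u /\ h ^+ m = 1.
Proof.
have [h [h2 uh2]] := perm_inverted_by_involution _ u.
have expm1 (g : 'S_n) : g ^+ 2 = 1 -> g ^+ m = 1.
  by move=> g2; rewrite -(even_halfK hm) -mul2n expgM g2 expg1n.
have hG : h \in Gtilde m u by rewrite inE !expm1.
split; first by apply/set0Pn; exists h.
by exists h; split; last exact: expm1.
Qed.
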